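(* Let $Q$ be a weak primary pseudoperfect number such that the set $\mathfrak{N}_Q=\{n\in\mathbb{N}: S_{Qn}(Qn)\equiv n\pmod{Qn}\}$ is non-empty. Then $\mathfrak{N}_Q$ has strictly positive asymptotic density.
   Context: $\mathbb{N}=\{1,2,3,\dots\}$. For positive integers $m,k$, $S_m(k):=1^m+2^m+\cdots+k^m$. A positive integer $Q$ is a weak primary pseudoperfect number if $\sum_{p\mid Q}\frac{Q}{p}+1\equiv 0\pmod{Q}$, the sum over primes $p$ dividing $Q$ (so $Q=1$ qualifies). The asymptotic density of a set $A\subseteq\mathbb{N}$ is $\lim_{N\to\infty}\frac{\#(A\cap[1,N])}{N}$ when this limit exists. *)

(* Defs.v *)
From mathcomp Require Import all_boot all_order all_algebra.
From mathcomp Require Import all_classical all_reals all_analysis.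
Import Order.TTheory GRing.Theory Num.Theory.
Import numFieldNormedType.Exports.

Set Implicit Arguments.
Unset Strict Implicit.
Unset Printing Implicit Defensive.

Local Open Scope classical_set_scope.
Local Open Scope ring_scope.

Definition power_sum (m k : nat) : nat := (\sum_(1 <= j < k.+1) j ^ m)%N.

(* [primes Q] is duplicate-free and [primes 1 = [::]], so [Q = 1] qualifies;
   each [Q %/ p] is an exact division. *)
Definition weak_primary_pseudoperfect (Q : nat) : Prop :=
  (0 < Q)%N /\ (\sum_(p <- primes Q) Q %/ p + 1 = 0 %[mod Q])%N.

Definition frakN (Q : nat) : set nat :=
  [set n : nat | (0 < n)%N /\
                 (power_sum (Q * n) (Q * n) = n %[mod Q * n])%N].

(* [iota 1 N] lists the integers of [1, N]. The term at [N = 0] is [0 / 0],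
   which is [0] by convention and does not affect the limit. *)
Definition has_asymptotic_density (R : realType) (A : set nat) (d : R) : Prop :=
  ((count (fun n : nat => n \in A) (iota 1 N))%:R / N%:R : R) @[N --> \oo] --> d.

(* Main.v *)
(** Put [m = Q n]. If [p^a] exactly divides [m], then [p^a] divides the exponent
    [m], so [j^m mod p^a] depends only on [j mod p] and
    [S_m(m) = (m/p) \sum_(x < p) x^m] modulo [p^a]; the last sum is [-1] or [0]
    modulo [p] according to whether [p - 1] divides [m]. Since
    [Q/p + 1 = 0 (mod p)] for every prime [p | Q], the number [n] is in the set
    iff [p - 1 | Q n] for all primes [p | Q] and [p (p - 1)] does not divide
    [Q n] for any prime [p] not dividing [Q].

    The first condition says that [n = L k] for a fixed [L]; the second one says
    that [k] avoids the multiples of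
    [e_p = p (p - 1) / gcd (p (p - 1), Q L)]. Non-emptiness gives [e_p > 1], and
    [\sum_p 1/e_p] converges. Sieving by one more modulus [e] multiplies the
    density by at least [1 - 1/e], so the densities of the finite sieves decrease
    to a positive limit, and the convergence of [\sum_p 1/e_p] makes this limit
    the density of the full sieve. *)

Require Import Defs.
From mathcomp Require Import all_boot all_order all_algebra.
From mathcomp Require Import all_classical all_reals all_analysis.
From mathcomp Require Import finfield zify ring lra.
Import Order.TTheory GRing.Theory Num.Theory.
Import numFieldNormedType.Exports.
Local Open Scope classical_set_scope.
Local Open Scope ring_scope.

(** * Power sums modulo prime powers, and the criterion for membership *)

(** Each [p]-th power gains a factor [p]: [Y ^ p - X ^ p] is [Y - X] times a sum of [p] terms, all
    congruent to [X ^ p.-1] modulo [p]. *)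
Lemma eqn_mod_exp_lift (p k x y : nat) :
  prime p -> (x = y %[mod p])%N -> (x ^ (p ^ k) = y ^ (p ^ k) %[mod p ^ k.+1])%N.
Proof.
move=> p_pr; wlog le_xy : x y / (x <= y)%N => [hw|].
  by case: (leqP x y) => [/hw//|/ltnW /hw h /esym /h].
move=> exy; elim: k => [|k IH]; first by rewrite expn0 expn1 !expn1.
rewrite [in LHS]expnSr [in RHS]expnSr !expnM.
set X := (x ^ (p ^ k))%N in IH *; set Y := (y ^ (p ^ k))%N in IH *.
have leXY : (X <= Y)%N by rewrite leq_exp2r // expn_gt0 (prime_gt0 p_pr).
have dXY : (p ^ k.+1 %| Y - X)%N by rewrite -eqn_mod_dvd //; exact/eqP/esym.
have leXp : (X ^ p <= Y ^ p)%N by rewrite (@leq_exp2r X Y p (prime_gt0 p_pr)).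
apply/esym/eqP; rewrite eqn_mod_dvd //. 
rewrite subn_exp [(p ^ k.+2)%N]expnSr; apply: dvdn_mul => //.
have eXY : (Y = X %[mod p])%N.
  by apply/eqP; rewrite eqn_mod_dvd //; apply: dvdn_trans dXY; exact: dvdn_exp.
apply/eqP.
transitivity ((\sum_(i < p) X ^ p.-1) %% p)%N; last first.
  by rewrite sum_nat_const card_ord modnMr.
rewrite -modn_summ -[in RHS]modn_summ; congr (_ %% p)%N; apply: eq_bigr => i _.
rewrite -modnMml -modnXm eXY modnXm modnMml -expnD subnK //.
by rewrite -ltnS prednK ?prime_gt0.
Qed.

(** The boolean, read as 0 or 1, covers the residues 0 and -1 without subtraction. If [p.-1] divides
    [m], every nonzero [x] contributes 1; otherwise the sum over the field is invariant under
    multiplication by some [g ^+ m != 1], so it vanishes. *)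
Lemma sum_expn_mod_prime (p m : nat) : prime p -> (0 < m)%N ->
  (p %| \sum_(x < p) x ^ m + (p.-1 %| m)%N)%N.
Proof.
move=> p_pr m_gt0.
have p_gt0 := prime_gt0 p_pr.
rewrite (dvdn_pcharf (pchar_Fp p_pr)) natrD natr_sum.
have expp (x : 'F_p) : x != 0 -> x ^+ p.-1 = 1.
  move=> x0; apply: (mulfI x0); rewrite mulr1 -exprS prednK //.
  by have := expf_card x; rewrite card_Fp.
have -> : \sum_(x < p) ((x ^ m)%N%:R : 'F_p) = \sum_(x : 'F_p) x ^+ m.
  rewrite (reindex (cast_ord (Fp_cast p_pr))) /=; last first.
    by exists (cast_ord (esym (Fp_cast p_pr))) => x _; rewrite ?cast_ordK ?cast_ordKV.
  by apply: eq_bigr => x _; rewrite natrX /= natr_Zp.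
case: (boolP (p.-1 %| m)%N) => [/dvdnP[k ek]|ndvd].
  rewrite (bigD1 0) //= expr0n (gtn_eqF m_gt0) add0r.
  rewrite (eq_bigr (fun=> 1)) => [|x x0]; last first.
    by rewrite ek mulnC exprM expp // expr1n.
  rewrite sumr_const cardC1 card_Fp // -natrD addn1 prednK //.
  by rewrite pchar_Fp_0.
rewrite addr0.
(* Otherwise all [p.-1] nonzero elements would be roots of [X^r - 1] with [r = m %% p.-1], where
   [0 < r < p.-1]. *)
have [g g0 gm] : exists2 g : 'F_p, g != 0 & g ^+ m != 1.
  case: (boolP [exists x : 'F_p, (x != 0) && (x ^+ m != 1)]).
    by move=> /existsP[g /andP[]]; exists g.
  rewrite negb_exists => /forallP H; exfalso.
  have r_gt0 : (0 < m %% p.-1)%N by rewrite lt0n.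
  have := @max_unity_roots 'F_p (m %% p.-1) (enum (predC1 (0 : 'F_p))) r_gt0.
  rewrite enum_uniq -cardE cardC1 card_Fp // => /(_ _ isT).
  have p1 : (0 < p.-1)%N by have := prime_gt1 p_pr; lia.
  rewrite leqNgt ltn_mod p1 => h; apply/notF/h.
  apply/allP => x; rewrite mem_enum inE => x0.
  have := H x; rewrite x0 /= negbK => /eqP xm.
  rewrite unity_rootE -xm {2}(divn_eq m p.-1) exprD mulnC exprM expp //.
  by rewrite expr1n mul1r.
apply/eqP/(mulfI (x := g ^+ m - 1)); first by rewrite subr_eq0.
rewrite mulr0 mulrBl mul1r mulr_sumr; apply/eqP; rewrite subr_eq0; apply/eqP.
rewrite [RHS](reindex_inj (mulfI g0)) /=.
by apply: eq_bigr => x _; rewrite exprMn.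
Qed.

Lemma power_sum_mod (p m : nat) : prime p -> (0 < m)%N -> (p %| m)%N ->
  (power_sum m m = m %/ p * \sum_(x < p) x ^ m %[mod p ^ logn p m])%N.
Proof.
move=> p_pr m_gt0 pm.
set a := logn p m.
have step j : (j ^ m = (j %% p) ^ m %[mod p ^ a])%N.
  have [v ev] := dvdnP (pfactor_dvdnn p m); rewrite -/a in ev.
  rewrite ev mulnC !expnM -modnXm -[in RHS]modnXm; congr (_ ^ _ %% _)%N.
  have h : (j ^ p ^ a = (j %% p) ^ p ^ a %[mod p ^ a.+1])%N.
    by apply: eqn_mod_exp_lift => //; rewrite modn_mod.
  have d : (p ^ a %| p ^ a.+1)%N by rewrite dvdn_exp2l.
  by rewrite -(modn_dvdm _ d) h modn_dvdm.
(* The range moves from [[1, m]] to [[0, m - 1]], that is, to [m %/ p] full periods: the term at 0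
   is zero and [m ^ m] vanishes modulo [p ^ a]. *)
have -> : power_sum m m = (\sum_(0 <= j < m) j ^ m + m ^ m)%N.
  by rewrite /power_sum -big_nat_recr //= [RHS]big_ltn //= ssrnat.exp0n.
have dm : (p ^ a %| m ^ m)%N.
  by apply: dvdn_trans (pfactor_dvdnn p m) _; exact: dvdn_exp.
rewrite -modnDmr (eqP dm) addn0 -[in LHS]modn_summ.
under eq_bigr do rewrite step.
rewrite modn_summ -{1}(divnK pm) big_nat_mul; congr (_ %% _)%N.
transitivity (\sum_(0 <= i < m %/ p) \sum_(x < p) x ^ m)%N; last first.
  by rewrite sum_nat_const_nat subn0.
apply: eq_bigr => i _.
rewrite -{1}[(i * p)%N]add0n big_addn mulSn addnK big_mkord; apply: eq_bigr => x _.
by rewrite addnC modnMDl modn_small.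
Qed.

(** For a prime [q != p] dividing [Q], [p] still divides [Q %/ q]; only the term of [p] survives
    modulo [p]. *)
Lemma weak_primary_pseudoperfect_dvdn (Q p : nat) :
  weak_primary_pseudoperfect Q -> prime p -> (p %| Q)%N -> (p %| Q %/ p + 1)%N.
Proof.
move=> [Q_gt0 hQ] p_pr pQ.
have : (p %| \sum_(q <- primes Q) Q %/ q + 1)%N.
  by apply: dvdn_trans pQ _; rewrite /dvdn hQ mod0n.
have pin : p \in primes Q by rewrite mem_primes p_pr Q_gt0.
rewrite (bigD1_seq p) ?primes_uniq //= addnAC dvdn_addl //.
rewrite big_seq_cond; apply: dvdn_sum => q /andP[].
rewrite mem_primes => /and3P[q_pr _ qQ] qp.
have co : coprime p q by rewrite prime_coprime // dvdn_prime2 // eq_sym.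
by rewrite -(Gauss_dvdr _ co) mulnC divnK.
Qed.

(** Let [T] be the sum of [x ^ m] over one period and [u] the part of [n] prime to [p]. If [p]
    divides [Q], it does so exactly once; cancelling the power of [p] in [n] leaves [(Q/p) u T = u]
    modulo [p], that is [T = -1], as [Q/p = -1]. If not, [n] vanishes modulo the prime power and the
    condition becomes [T = 0]. *)
Lemma power_sum_modP (Q n p : nat) :
  weak_primary_pseudoperfect Q -> (0 < n)%N -> prime p -> (p %| Q * n)%N ->
  reflect (power_sum (Q * n) (Q * n) = n %[mod p ^ logn p (Q * n)])%N
          ((p %| Q) == (p.-1 %| Q * n))%N.
Proof.
move=> wQ n_gt0 p_pr pm.
have Q_gt0 : (0 < Q)%N by case: wQ.
have m_gt0 : (0 < Q * n)%N by rewrite muln_gt0 Q_gt0.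
have p_gt0 := prime_gt0 p_pr; have p_gt1 := prime_gt1 p_pr.
rewrite power_sum_mod //.
have := sum_expn_mod_prime _ _ p_pr m_gt0.
set T := (\sum_(x < p) _)%N; set b := (p.-1 %| _)%N => hT.
apply: (equivP eqP); rewrite lognM //.
case: (boolP (p %| Q)%N) => [pQ|npQ].
  have hQp := weak_primary_pseudoperfect_dvdn _ _ wQ p_pr pQ.
  have lQ : logn p Q = 1%N.
    have npQp : ~~ (p %| Q %/ p)%N.
      by apply/negP => h; move: hQp; rewrite dvdn_addr // dvdn1 gtn_eqF.
    rewrite -{1}(divnK pQ) lognM ?divn_gt0 ?(dvdn_leq _ pQ) //.
    by rewrite (logn_prime p p_pr) eqxx logn_coprime ?prime_coprime.
  rewrite lQ add1n.
  have [u ncu en] := pfactor_coprime p_pr n_gt0.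
  have -> : (Q * n %/ p = Q %/ p * u * p ^ logn p n)%N.
    by rewrite -mulnA -en divn_mulAC.
  rewrite expnS mulnAC [X in _ = (X %% _)%N]en -!muln_modl.
  have -> (x y : nat) : (x * p ^ logn p n = y * p ^ logn p n)%N <-> x = y.
    by split=> [/eqP|->//]; rewrite eqn_pmul2r ?expn_gt0 ?p_gt0 // => /eqP.
  case: b hT => hT; split=> //.
    move=> _.
    apply/eqP; rewrite -(eqn_modDr (u * T)).
    have -> : (Q %/ p * u * T + u * T = (Q %/ p + 1) * (u * T))%N by lia.
    have -> : (u + u * T = u * (T + 1))%N by lia.
    by rewrite (eqP (dvdn_mulr _ hQp)) (eqP (dvdn_mull _ hT)).
  rewrite addn0 in hT; rewrite (eqP (dvdn_mull _ hT)) => /esym/eqP pu.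
  by move: ncu; rewrite prime_coprime // /dvdn pu.
have pn : (p %| n)%N by move: pm; rewrite Euclid_dvdM // (negbTE npQ).
rewrite logn_coprime ?prime_coprime // add0n (eqP (pfactor_dvdnn p n)).
have [u ncu en] := pfactor_coprime p_pr n_gt0.
have c_gt0 : (0 < logn p n)%N by rewrite logn_gt0 mem_primes p_pr n_gt0.
have -> : (Q * n %/ p = Q * u * p ^ (logn p n).-1)%N.
  by rewrite -(mulnK (Q * u * p ^ (logn p n).-1) p_gt0) -mulnA -expnSr prednK // -mulnA -en.
rewrite -{2}(prednK c_gt0) expnS mulnAC -muln_modl.
have -> : ((Q * u * T) %% p * p ^ (logn p n).-1 = 0)%N <-> (p %| T)%N.
  have co : coprime p (Q * u) by rewrite coprimeMr prime_coprime // npQ.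
  rewrite -(Gauss_dvdr T co).
  by split=> [/eqP|/eqP->//]; rewrite muln_eq0 expn_eq0 (gtn_eqF p_gt0) /= orbF.
case: b hT => [|]; rewrite ?addn0 => hT; split=> // pT.
by move: hT; rewrite dvdn_addr // dvdn1 gtn_eqF.
Qed.

(** The congruence is tested on each prime power part of [Q * n]. For [p] not dividing [Q], the
    requirement that [p] and [p.-1] not both divide [Q * n] is a single non-divisibility, since they
    are coprime. *)
Lemma frakNP (Q n : nat) :
  weak_primary_pseudoperfect Q ->
  frakN Q n <->
  [/\ (0 < n)%N, forall p, p \in primes Q -> (p.-1 %| Q * n)%N
    & forall p, prime p -> ~~ (p %| Q)%N -> ~~ (p * p.-1 %| Q * n)%N].
Proof.
move=> wQ; have Q_gt0 : (0 < Q)%N by case: wQ.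
rewrite /frakN /=.
split.
  move=> [n_gt0 /eqP].
  have m_gt0 : (0 < Q * n)%N by rewrite muln_gt0 Q_gt0.
  move=> /(modn_partP _ _ m_gt0) h.
  have key p : prime p -> (p %| Q * n)%N -> (p %| Q)%N = (p.-1 %| Q * n)%N.
    move=> p_pr pm; apply: (elimT eqP); apply/(power_sum_modP _ _ _ wQ n_gt0 p_pr pm).
    by rewrite -p_part; apply: h; rewrite mem_primes p_pr m_gt0.
  split=> // p.
    by rewrite mem_primes => /and3P[p_pr _ pQ]; rewrite -key // dvdn_mulr.
  move=> p_pr npQ; apply: contra npQ => d.
  have pm : (p %| Q * n)%N by apply: dvdn_trans d; exact: dvdn_mulr.
  by rewrite key //; apply: dvdn_trans d; exact: dvdn_mull.
move=> [n_gt0 h1 h2]; split=> //.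
have m_gt0 : (0 < Q * n)%N by rewrite muln_gt0 Q_gt0.
apply/eqP/(modn_partP _ _ m_gt0) => p.
rewrite mem_primes p_part => /and3P[p_pr _ pm]; apply/(power_sum_modP _ _ _ wQ n_gt0 p_pr pm).
case: (boolP (p %| Q)%N) => [pQ|npQ]; first by rewrite h1 // mem_primes p_pr Q_gt0.
rewrite eq_sym eqbF_neg; apply: contra (h2 p p_pr npQ) => d.
rewrite Gauss_dvd ?pm //; rewrite coprime_sym -{2}(prednK (prime_gt0 p_pr)).
exact: coprimenS.
Qed.

(** * Counting the integers that avoid a finite list of divisors *)

Lemma dvdn_mul_cofactor (d k n : nat) : (0 < d)%N ->
  (d %| k * n)%N = (d %/ gcdn d k %| n)%N.
Proof.
move=> d_gt0; have g_gt0 : (0 < gcdn d k)%N by rewrite gcdn_gt0 d_gt0.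
have ed := divnK (dvdn_gcdl d k); have ek := divnK (dvdn_gcdr d k).
set g := gcdn d k in g_gt0 ed ek *.
have co : coprime (d %/ g) (k %/ g).
  by rewrite /coprime -(eqn_pmul2r g_gt0) muln_gcdl ed ek mul1n.
by rewrite -{1}ed -{1}ek mulnAC dvdn_pmul2r // Gauss_dvdr.
Qed.

Lemma count_iota1S (P : pred nat) (N : nat) :
  count P (iota 1 N.+1) = (count P (iota 1 N) + P N.+1)%N.
Proof. by rewrite -[in LHS](addn1 N) (iotaD 1 N 1) count_cat /= addn0 add1n. Qed.

Lemma count_multiples (P : pred nat) (L N : nat) : (0 < L)%N ->
  count [pred n | (L %| n)%N && P n] (iota 1 N) =
  count (fun n => P (L * n)%N) (iota 1 (N %/ L)).
Proof.
move=> L_gt0; elim: N => [|N IH]; first by rewrite div0n.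
rewrite count_iota1S IH divnS //= ; case: (boolP (L %| N.+1)%N) => [h|_]; last first.
  by rewrite add0n addn0.
by rewrite add1n count_iota1S -add1n; congr (_ + P _)%N; rewrite mulnC -{1}(divnK h) divnS // h.
Qed.

Definition sifted (s : seq nat) : pred nat :=
  fun n => all (fun e => ~~ (e %| n)%N) s.

(** The second count is that of the multiples [e * k] surviving [s]: [d] divides [e * k] iff
    [d %/ gcdn d e] divides [k]. *)
Lemma count_sifted_cons (e : nat) (s : seq nat) (N : nat) :
  (0 < e)%N -> all (leq 1) s ->
  (count (sifted (e :: s)) (iota 1 N) +
   count (sifted [seq (d %/ gcdn d e)%N | d <- s]) (iota 1 (N %/ e)) =
   count (sifted s) (iota 1 N))%N.
Proof.
move=> e_gt0 s_gt0.
have -> : count (sifted [seq (d %/ gcdn d e)%N | d <- s]) (iota 1 (N %/ e)) =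
          count (fun n => sifted s (e * n)%N) (iota 1 (N %/ e)).
  apply: eq_count => n; rewrite /sifted all_map; apply: eq_in_all => d ds /=.
  by rewrite dvdn_mul_cofactor // (allP s_gt0).
rewrite -count_multiples // -count_predUI addnC.
rewrite (eq_count (a2 := pred0)) ?count_pred0 => [|n]; last first.
  by rewrite /=; case: (e %| n)%N; rewrite ?andbF.
rewrite add0n; apply: eq_count => n /=.
by case: (e %| n)%N => //=; rewrite ?orbF ?andbT.
Qed.

(* With [count_sifted_cons], this bounds what the modulus [e] removes up to [N]
   by what the sieve by [s] leaves up to [N / e]. *)
Lemma sub_sifted_cofactor (e : nat) (s : seq nat) :
  subpred (sifted [seq (d %/ gcdn d e)%N | d <- s]) (sifted s).
Proof.
move=> n; rewrite /sifted all_map; apply: sub_all => d /=.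
apply: contra; apply: dvdn_trans; apply/dvdnP; exists (gcdn d e).
  by rewrite mulnC divnK ?dvdn_gcdl.
Qed.

(** * Densities of finite sieves *)

(** Finite sieves satisfy this with [eps = 0], a bounded error; the infinite sieve only for every
    [eps > 0], with [K] depending on [eps]. *)
Definition near_linear {R : realType} (f : nat -> nat) (d eps K : R) : Prop :=
  forall N : nat, `|(f N)%:R - d * N%:R| <= eps * N%:R + K.

Definition count_upto (P : pred nat) (N : nat) : nat := count P (iota 1 N).

Lemma linear_bound_le0 {R : realType} (a K : R) :
  (forall N : nat, a * N%:R <= K) -> a <= 0.
Proof.
move=> h; rewrite leNgt; apply/negP => a0.
have /= ltN := archi_boundP (normr_ge0 (K / a)).
have := h (Num.bound `|K / a|); rewrite leNgt => /negP; apply.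
by rewrite mulrC -ltr_pdivrMr //; apply: le_lt_trans ltN; exact: ler_norm.
Qed.

Lemma near_linear_le {R : realType} (f g : nat -> nat) (d d' K K' : R) :
  near_linear f d 0 K -> near_linear g d' 0 K' ->
  (forall N, (f N <= g N)%N) -> d <= d'.
Proof.
move=> hf hg fg; rewrite -subr_le0; apply: (@linear_bound_le0 _ _ (K + K')) => N.
have := hf N; have := hg N; have := fg N; rewrite -(ler_nat R) !ler_norml.
by move=> ? /andP[? ?] /andP[? ?]; lra.
Qed.

Lemma truncdiv_bound {R : realType} (N L : nat) : (0 < L)%N ->
  0 <= (N%:R / L%:R - (N %/ L)%N%:R : R) <= 1.
Proof.
move=> L_gt0; have L0 : (0 : R) < L%:R by rewrite ltr0n.
apply/andP; split.
  by rewrite subr_ge0 ler_pdivlMr // -natrM ler_nat leq_trunc_div.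
rewrite lerBlDr ler_pdivrMr // nat1r -natrM ler_nat.
by rewrite mulnC ltnW // mulnC ltn_ceil.
Qed.

Lemma near_linear_div {R : realType} (f : nat -> nat) (d eps K : R) (L : nat) :
  (0 < L)%N -> 0 <= d -> 0 <= eps -> near_linear f d eps K ->
  near_linear (fun N => f (N %/ L)%N) (d / L%:R) eps (K + d).
Proof.
move=> L_gt0 d0 e0 hf N; have := hf (N %/ L)%N.
have /andP[h1 h2] := @truncdiv_bound R N L L_gt0.
have h3 : (N %/ L)%N%:R <= N%:R :> R by rewrite ler_nat leq_div.
rewrite !ler_norml -mulrA [L%:R^-1 * _]mulrC; move: h1 h2 h3.
move: (N%:R / L%:R) ((N %/ L)%N%:R : R) => x y.
move=> h1 h2 h3 /andP[h4 h5].
by apply/andP; split; nra.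
Qed.

(** The induction is on the length, because [count_sifted_cons] needs the result for [s] and also
    for another list of the same length. *)
Lemma sifted_near_linear (R : realType) (s : seq nat) : all (leq 1) s ->
  exists d K : R, 0 <= d /\ near_linear (count_upto (sifted s)) d 0 K.
Proof.
have [n] := ubnP (size s); elim: n s => // n IH [|e s] /=.
  move=> _ _; exists 1, 0; split=> // N.
  rewrite /count_upto (eq_count (a2 := predT)) // count_predT size_iota.
  by rewrite mul1r subrr normr0 mul0r addr0.
rewrite ltnS => ltsn /andP[e_gt0 s_gt0].
have [d [K [d0 hs]]] := IH s ltsn s_gt0.
have [||d' [K' [d'0 hs']]] := IH [seq (d %/ gcdn d e)%N | d <- s].
- by rewrite size_map.
- rewrite all_map; apply: sub_all s_gt0 => x /= x0.
  by rewrite divn_gt0 ?gcdn_gt0 ?x0 // dvdn_leq // dvdn_gcdl.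
have hd := near_linear_div _ _ _ _ _ e_gt0 d'0 (lexx _) hs'.
exists (d - d' / e%:R), (K + (K' + d')); split.
  rewrite subr_ge0; apply: near_linear_le hd hs _ => N.
  by rewrite /count_upto -(count_sifted_cons e s N) // leq_addl.
move=> N; have := hs N; have := hd N.
rewrite /count_upto -(count_sifted_cons e s N) // natrD mulrBl !ler_norml.
by move=> /andP[? ?] /andP[? ?]; apply/andP; split; lra.
Qed.

(** One step of the Heilbronn-Rohrbach inequality. The moduli may share factors, but the integers
    removed by [e] are at most as dense as the survivors of [s] up to [N / e], whence the loss
    [d / e]. *)
Lemma near_linear_sifted_cons {R : realType} (e : nat) (s : seq nat) (d d' K K' : R) :
  (0 < e)%N -> all (leq 1) s -> 0 <= d ->
  near_linear (count_upto (sifted s)) d 0 K ->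
  near_linear (count_upto (sifted (e :: s))) d' 0 K' ->
  d * (1 - e%:R^-1) <= d' <= d.
Proof.
move=> e_gt0 s_gt0 d0 h h'; apply/andP; split; last first.
  apply: near_linear_le h' h _ => N.
  by rewrite /count_upto -(count_sifted_cons e s N) // leq_addr.
have hd := near_linear_div _ _ _ _ _ e_gt0 d0 (lexx _) h.
rewrite mulrBr mulr1 -subr_le0; apply: (@linear_bound_le0 _ _ (K + K' + (K + d))) => N.
have := hd N; have := h N; have := h' N.
have : (count_upto (sifted s) N <= count_upto (sifted (e :: s)) N + count_upto (sifted s) (N %/ e))%N.
  rewrite /count_upto -{1}(count_sifted_cons e s N) // leq_add2l.
  exact/sub_count/sub_sifted_cofactor.
rewrite -(ler_nat R) natrD !ler_norml.
by move=> ? /andP[? ?] /andP[? ?] /andP[? ?]; lra.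
Qed.

(** * The infinite sieve *)

(** The newest modulus is at the head, so that passing from [T] to [T.+1] is a cons, as in
    [count_sifted_cons]. *)
Fixpoint moduli (g : pred nat) (e : nat -> nat) (T : nat) : seq nat :=
  if T is T'.+1 then
    if g T' then e T' :: moduli g e T' else moduli g e T'
  else [::].

Lemma sifted_moduliP (g : pred nat) (e : nat -> nat) (T n : nat) :
  reflect (forall p, (p < T)%N -> g p -> ~~ (e p %| n)%N)
          (sifted (moduli g e T) n).
Proof.
apply: (iffP idP).
  elim: T => // T IH /=; case: ifPn => gT.
    move=> /= /andP[eT /IH h] p; rewrite ltnS leq_eqVlt => /predU1P[->//|]; exact: h.
  move=> /IH h p; rewrite ltnS leq_eqVlt => /predU1P[->|]; last exact: h.
  by rewrite (negbTE gT).
elim: T => // T IH h /=.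
have {}IH : sifted (moduli g e T) n by apply: IH => p /ltnW; exact: h.
by case: ifPn => //= gT; rewrite h.
Qed.

(* The growth condition is [1 / e p <= C (1 / p - 1 / (p + 1))], so that the tail
   of [\sum 1 / e p] from [T] on telescopes to at most [C / T]. *)
Lemma sieve_near_linear (R : realType) (g : pred nat) (e : nat -> nat)
    (C : nat) (P : pred nat) :
  (forall p, g p -> (1 < e p)%N /\ (p * p.+1 <= C * e p)%N) ->
  (forall n, (0 < n)%N -> P n <-> forall p, g p -> ~~ (e p %| n)%N) ->
  exists2 d : R, 0 < d &
    forall eps, 0 < eps -> exists K, near_linear (count_upto P) d eps K.
Proof.
move=> hg hP.
have s_gt0 T : all (leq 1) (moduli g e T).
  elim: T => //= T IH; case: ifPn => //= gT; rewrite IH andbT.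
  by have [/ltnW] := hg T gT.
have /boolp.choice[DK hDK] : forall T, exists dK : R * R,
    0 <= dK.1 /\ near_linear (count_upto (sifted (moduli g e T))) dK.1 0 dK.2.
  by move=> T; have [d [K h]] := sifted_near_linear R _ (s_gt0 T); exists (d, K).
pose D T := (DK T).1.
have D0 T : 0 <= D T by case: (hDK T).
have einv T : g T -> (0 < T)%N -> ((e T)%:R^-1 : R) <= C%:R * (T%:R^-1 - T.+1%:R^-1).
  case: T => // T gT _; have [e1 eC] := hg _ gT.
  have -> : (T.+1%:R^-1 - T.+2%:R^-1 : R) = (T.+1%:R * T.+2%:R)^-1.
    have x0 : (T.+1%:R : R) != 0 by rewrite pnatr_eq0.
    have : (T.+2%:R : R) != 0 by rewrite pnatr_eq0.
    rewrite -(natr1 T.+1); move: (T.+1%:R : R) x0 => x x0 x1.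
    by field; apply/andP.
  rewrite ler_pdivlMr // mulrC ler_pdivrMr ?ltr0n ?(ltnW e1) //.
  by rewrite -!natrM ler_nat.
have Dstep T : D T.+1 <= D T /\
    (D T * (if g T then 1 - (e T)%:R^-1 else 1) <= D T.+1).
  have [DT hT] := hDK T; have [_ hT'] := hDK T.+1.
  rewrite /= in hT'; move: hT'; case: ifPn => gT hT'.
    have [e1 _] := hg T gT.
    by have /andP[] := near_linear_sifted_cons _ _ _ _ _ _ (ltnW e1) (s_gt0 T) DT hT hT'.
  (* [DK] chooses separately for each [T], so even for an unchanged list the two densities must be
     compared through the counts. *)
  by rewrite mulr1; split; [apply: near_linear_le hT' hT _ | apply: near_linear_le hT hT' _].
have Dpos T : 0 < D T.
  elim: T => [|T IH].
    have [_ h0] := hDK 0%N.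
    suff : (1 : R) - D 0%N <= 0 by lra.
    apply: (@linear_bound_le0 _ _ (DK 0%N).2) => N.
    have := h0 N; rewrite /count_upto (eq_count (a2 := predT)) // count_predT size_iota.
    by rewrite ler_norml -/(D 0%N) => /andP[? ?]; lra.
  have [_] := Dstep T; apply: lt_le_trans; rewrite mulr_gt0 //.
  case: ifPn => // gT; have [e1 _] := hg T gT.
  by rewrite subr_gt0 invf_lt1 ?ltr0n ?ltr1n // ltnW.
have Dmono : {homo D : n m / (n <= m)%N >-> m <= n}.
  by apply: homo_leq => [//|x y z h1 h2|T]; [exact: le_trans h2 h1 | case: (Dstep T)].
(* A new modulus costs at most [D (T + k) / e (T + k)], hence at most [D T / e (T + k)]; measured
   against the fixed [D T], the losses telescope. *)
have Dlow T k : (0 < T)%N ->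
    D T * (1 - C%:R * (T%:R^-1 - (T + k)%N%:R^-1)) <= D (T + k)%N.
  move=> T0; elim: k => [|k IH]; first by rewrite addn0 subrr mulr0 subr0 mulr1.
  have [_] := Dstep (T + k)%N; rewrite addnS; apply: le_trans.
  have w0 : 0 <= C%:R * ((T + k)%N%:R^-1 - (T + k).+1%:R^-1 : R).
    by rewrite mulr_ge0 // subr_ge0 lef_pV2 ?posrE ?ltr0n ?ler_nat ?addn_gt0 ?T0.
  have w1 : D T * (C%:R * ((T + k)%N%:R^-1 - (T + k).+1%:R^-1)) >=
            D (T + k)%N * (C%:R * ((T + k)%N%:R^-1 - (T + k).+1%:R^-1)).
    by rewrite ler_wpM2r // Dmono ?leq_addr.
  have w2 : D (T + k)%N * (C%:R * ((T + k)%N%:R^-1 - (T + k).+1%:R^-1)) >=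
            D (T + k)%N - D (T + k)%N * (if g (T + k)%N then 1 - (e (T + k)%N)%:R^-1 else 1).
    case: ifPn => gT; last by rewrite mulr1 subrr mulr_ge0.
    have -> (x y : R) : x - x * (1 - y) = x * y by ring.
    by rewrite ler_wpM2l // einv ?addn_gt0 ?T0.
  move: IH w0 w1 w2; move: (if _ then _ else _) => w.
  move: (T%:R^-1) ((T + k)%N%:R^-1) ((T + k).+1%:R^-1) => a b c.
  by move: (D T) (D (T + k)%N) => x y *; lra.
have cntstep T N : (0 < T)%N ->
  (count_upto (sifted (moduli g e T)) N)%:R <=
  (count_upto (sifted (moduli g e T.+1)) N)%:R + N%:R * (C%:R * (T%:R^-1 - T.+1%:R^-1)) :> R.
  move=> T0 /=.
  have w0 : 0 <= C%:R * (T%:R^-1 - T.+1%:R^-1 : R).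
    by rewrite mulr_ge0 // subr_ge0 lef_pV2 ?posrE ?ltr0n ?ler_nat.
  case: ifPn => gT; last by rewrite lerDl mulr_ge0.
  have [e1 _] := hg T gT.
  rewrite {1}/count_upto -(count_sifted_cons (e T)) ?(ltnW e1) // natrD lerD2l.
  apply: (@le_trans _ _ ((N %/ e T)%N%:R)).
    by rewrite ler_nat; apply: leq_trans (count_size _ _) _; rewrite size_iota.
  have /andP[h _] := @truncdiv_bound R N (e T) (ltnW e1).
  by apply: le_trans (ler_wpM2l (ler0n _ N) (einv T gT T0)); lra.
have cntlow T k N : (0 < T)%N ->
  (count_upto (sifted (moduli g e T)) N)%:R <=
  (count_upto (sifted (moduli g e (T + k))) N)%:R
    + N%:R * (C%:R * (T%:R^-1 - (T + k)%N%:R^-1)) :> R.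
  move=> T0; elim: k => [|k IH]; first by rewrite addn0 subrr !mulr0 addr0.
  have := cntstep (T + k)%N N; rewrite addn_gt0 T0 addnS => /(_ isT); move: IH.
  move: (T%:R^-1) ((T + k)%N%:R^-1) ((T + k).+1%:R^-1) => a b c.
  by move=> *; lra.
(* If [p > C * N], the growth condition forces [e p > N], so up to [N] a finite sieve agrees exactly
   with [P]. *)
have cntP T N : count_upto (sifted (moduli g e (T + (C * N).+1))) N = count_upto P N.
  apply: eq_in_count => n; rewrite mem_iota add1n ltnS => /andP[n0 nN].
  apply/sifted_moduliP/idP => [h|/(hP n n0) h p _]; last exact: h.
  apply/(hP n n0) => p gp; have [pT|Tp] := ltnP p (T + (C * N).+1); first exact: h.
  apply/negP => /(dvdn_leq n0) epn; have [_ pC] := hg p gp.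
  have : (C * e p <= C * N)%N by rewrite leq_mul2l (leq_trans epn) ?orbT.
  by nia.
have cntup T N : (count_upto P N <= count_upto (sifted (moduli g e T)) N)%N.
  rewrite -(cntP T); apply: sub_count => n /sifted_moduliP h.
  by apply/sifted_moduliP => p pT; apply: h; rewrite ltn_addr.
have Dcvg : cvgn D.
  by apply: nonincreasing_is_cvgn => //; exists 0 => _ [T _ <-].
have lim_le T : limn D <= D T by exact: nonincreasing_cvgn_ge.
exists (limn D).
  (* With [C / T <= 1/2] the moduli from [T] on lose at most half of [D T]. *)
  pose T := (2 * C).+1.
  have T0 : (0 : R) < T%:R by rewrite ltr0n.
  have CT : C%:R * T%:R^-1 <= (2^-1 : R).
    by rewrite ler_pdivrMr // mulrC ler_pdivlMr // -natrM ler_nat /T; lia.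
  apply: (@lt_le_trans _ _ (D T / 2)); first by rewrite divr_gt0.
  apply: limr_ge => //; exists T => // n /= Tn.
  have := Dlow T (n - T)%N isT; rewrite subnKC //; apply: le_trans.
  rewrite ler_wpM2l //.
  have : 0 <= C%:R * (n%:R^-1 : R) by rewrite mulr_ge0 // invr_ge0.
  by lra.
move=> eps eps0.
(* The bound on [D T] gives the upper estimate for [P], the bound on [C / T] the lower one. *)
have [T [T0 DT CT]] : exists T, [/\ (0 < T)%N, D T <= limn D + eps / 2 & C%:R / T%:R <= eps / 2].
  move/cvgrPdist_le : Dcvg => /(_ (eps / 2)); rewrite divr_gt0 // => /(_ isT)[T1 _ hT1].
  have /= ltN := archi_boundP (normr_ge0 (C%:R / (eps / 2))).
  set T2 := Num.bound _ in ltN.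
  exists (maxn T1 T2).+1; split=> //.
    have := hT1 (maxn T1 T2).+1; rewrite /= leqW ?leq_maxl // => /(_ isT).
    by rewrite ler_norml => /andP[? ?]; lra.
  rewrite ler_pdivrMr ?ltr0n // mulrC -ler_pdivrMr ?divr_gt0 //.
  apply: le_trans (ler_norm _) _; apply: le_trans (ltW ltN) _.
  by rewrite ler_nat leqW // leq_maxr.
exists (DK T).2 => N; have [_ /(_ N)] := hDK T; rewrite -/(D T).
have := cntlow T (C * N).+1 N T0; rewrite cntP.
have := cntup T N; rewrite -(ler_nat R) => h1 h2.
have h3 : 0 <= C%:R * ((T + (C * N).+1)%N%:R^-1 : R) by rewrite mulr_ge0 // invr_ge0.
have h4 := ler0n R N; have h5 := lim_le T.
rewrite !ler_norml => /andP[h6 h7].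
have h8 : D T * N%:R <= (limn D + eps / 2) * N%:R by rewrite ler_wpM2r.
have h9 : limn D * N%:R <= D T * N%:R by rewrite ler_wpM2r.
have h10 : N%:R * (C%:R * (T%:R^-1 - (T + (C * N).+1)%N%:R^-1)) <= N%:R * (eps / 2).
  by rewrite ler_wpM2l //; lra.
have h11 : 0 <= eps * N%:R by rewrite mulr_ge0 // ltW.
by apply/andP; split; lra.
Qed.

(** * From the sieve to the density of the set *)

Lemma has_asymptotic_density_near_linear (R : realType) (A : set nat) (d : R) :
  (forall eps, 0 < eps ->
     exists K, near_linear (count_upto (fun n => n \in A)) d eps K) ->
  has_asymptotic_density A d.
Proof.
move=> h; apply/cvgrPdist_le => eps eps0.
have [K hK] := h (eps / 2) (divr_gt0 eps0 (ltr0n _ 2)).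
have /= ltN := archi_boundP (normr_ge0 (K / (eps / 2))).
set M := Num.bound _ in ltN.
(* Beyond [M] the constant [K] is at most [eps / 2 * N]; the successor also keeps [N] nonzero. *)
exists M.+1 => // N /= MN.
have N0 : (0 : R) < N%:R by rewrite ltr0n; apply: leq_trans MN.
rewrite distrC -[d](mulfK (lt0r_neq0 N0)) -mulrBl normrM normfV (ger0_norm (ltW N0)).
rewrite ler_pdivrMr //; apply: le_trans (hK N) _.
suff : K <= N%:R * (eps / 2) by lra.
rewrite -ler_pdivrMr ?divr_gt0 //.
apply: le_trans (ler_norm _) _; apply: le_trans (ltW ltN) _.
by rewrite ler_nat ltnW.
Qed.

Lemma common_multiple_generator (s : seq nat) : all (leq 1) s ->
  exists2 L : nat, (0 < L)%N & forall n, all (dvdn^~ n) s = (L %| n)%N.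
Proof.
elim: s => [|d s IH] /=; first by exists 1%N => // n; rewrite dvd1n.
move=> /andP[d0 /IH[L L0 hL]]; exists (lcmn d L); first by rewrite lcmn_gt0 d0.
by move=> n; rewrite dvdn_lcm hL.
Qed.

Theorem theorem3 (R : realType) (Q : nat) :
  weak_primary_pseudoperfect Q ->
  frakN Q !=set0 ->
  exists d : R, 0 < d /\ has_asymptotic_density (frakN Q) d.
Proof.
move=> wQ [n0 /(frakNP _ _ wQ)[n0_gt0 h1 h2]].
have Q_gt0 : (0 < Q)%N by case: wQ.
have pred_gt0 p : prime p -> (0 < p.-1)%N by move/prime_gt1; case: p => [|[]].
have [|L L_gt0 hL] :=
    common_multiple_generator [seq (p.-1 %/ gcdn p.-1 Q)%N | p <- primes Q].
  rewrite all_map; apply/allP => p; rewrite mem_primes => /and3P[/pred_gt0 p0 _ _] /=.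
  by rewrite divn_gt0 ?gcdn_gt0 ?p0 // dvdn_leq // dvdn_gcdl.
have {}hL n : (L %| n)%N <-> forall p, p \in primes Q -> (p.-1 %| Q * n)%N.
  rewrite -hL all_map; split=> [/allP h p pQ|h].
    have := h p pQ; rewrite /= -dvdn_mul_cofactor //.
    by move: pQ; rewrite mem_primes => /and3P[/pred_gt0].
  apply/allP => p pQ; rewrite /= -dvdn_mul_cofactor ?h //.
  by move: pQ; rewrite mem_primes => /and3P[/pred_gt0].
pose g p := prime p && ~~ (p %| Q)%N.
pose e p := (p * p.-1 %/ gcdn (p * p.-1) (Q * L))%N.
pose P n := ((L * n)%N \in frakN Q).
have eE p n : prime p -> (p * p.-1 %| Q * (L * n))%N = (e p %| n)%N.
  by move=> p_pr; rewrite mulnA dvdn_mul_cofactor // muln_gt0 prime_gt0 ?pred_gt0.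
have hP n : (0 < n)%N -> P n <-> forall p, g p -> ~~ (e p %| n)%N.
  move=> n_gt0; split.
    move=> /set_mem/(frakNP _ _ wQ)[_ _ h] p /andP[p_pr npQ].
    by rewrite -eE // h.
  move=> h; apply/mem_set/(frakNP _ _ wQ); split; first by rewrite muln_gt0 L_gt0.
    by apply/hL; rewrite dvdn_mulr.
  by move=> p p_pr npQ; rewrite eE // h // /g p_pr.
(* The constant comes from [p + 1 <= 3 (p - 1)] for [p >= 2] and from the gcd being at most [Q * L].
   If [e p] were 1, [p * p.-1] would divide [Q * n] for all multiples [n] of [L], among them
   [n0]. *)
have hg p : g p -> (1 < e p)%N /\ (p * p.+1 <= 3 * (Q * L) * e p)%N.
  move=> gp; have /andP[p_pr npQ] := gp.
  have pp_gt0 : (0 < p * p.-1)%N by rewrite muln_gt0 prime_gt0 ?pred_gt0.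
  have g_gt0 : (0 < gcdn (p * p.-1) (Q * L))%N by rewrite gcdn_gt0 pp_gt0.
  have e_gt0 : (0 < e p)%N by rewrite divn_gt0 // dvdn_leq // dvdn_gcdl.
  split.
    rewrite ltn_neqAle e_gt0 andbT eq_sym; apply/negP => /eqP e1.
    have := h2 p p_pr npQ; have /hL/dvdnP[k ->] := h1.
    by rewrite [(k * L)%N]mulnC eE // e1 dvd1n.
  have eg : (e p * gcdn (p * p.-1) (Q * L) = p * p.-1)%N by rewrite divnK ?dvdn_gcdl.
  have gQL : (gcdn (p * p.-1) (Q * L) <= Q * L)%N.
    by rewrite dvdn_leq ?dvdn_gcdr // muln_gt0 Q_gt0.
  have : (e p * gcdn (p * p.-1) (Q * L) <= e p * (Q * L))%N by rewrite leq_mul2l gQL orbT.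
  rewrite eg; have := prime_gt1 p_pr; move: (Q * L)%N (e p) => c x; nia.
(* All members are multiples of [L], so counting them up to [N] is counting their quotients up to
   [N %/ L]. *)
have cE N : count_upto P (N %/ L)%N = count_upto (fun n => n \in frakN Q) N.
  apply: etrans (esym (count_multiples (fun n => n \in frakN Q) L N L_gt0)) _.
  apply: eq_count => n /=; case: (boolP (n \in frakN Q)) => [nN|]; last by rewrite andbF.
  by rewrite andbT; apply/hL; have [] := (frakNP _ _ wQ).1 (set_mem nN).
have [d d_gt0 hd] := @sieve_near_linear R _ _ _ _ hg hP.
exists (d / L%:R); split; first by rewrite divr_gt0 ?ltr0n.
apply: has_asymptotic_density_near_linear => eps eps0.
have [K hK] := hd eps eps0; exists (K + d) => N; rewrite -cE.
exact: (near_linear_div _ _ _ _ _ L_gt0 (ltW d_gt0) (ltW eps0) hK N).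
Qed.
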